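(* For any positive integers $r,t$, $$edim(C_{4r}\Box C_{4t})=3.$$
   Context: All graphs are finite and simple. $C_n$ denotes the cycle with $n$ vertices. The Cartesian product $G\Box H$ has vertex set $V(G)\times V(H)$, with $(a,b)$ and $(c,d)$ adjacent if and only if either $a=c$ and $bd\in E(H)$, or $b=d$ and $ac\in E(G)$. For a connected graph $G=(V,E)$, $d_G(x,y)$ is the length of a shortest path between vertices $x,y$. The distance between a vertex $v$ and an edge $e=uw$ is $d_G(e,v)=\min\{d_G(u,v),d_G(w,v)\}$. A vertex $w$ distinguishes two edges $e_1,e_2$ if $d_G(w,e_1)\ne d_G(w,e_2)$. A set $S\subseteq V$ is an edge metric generator for $G$ if every two distinct edges of $G$ are distinguished by some vertex of $S$. The edge metric dimension $edim(G)$ is the smallest cardinality of an edge metric generator for $G$. *)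

(* Defs.v *)
From mathcomp Require Import all_boot.

Set Implicit Arguments.
Unset Strict Implicit.
Unset Printing Implicit Defensive.

Record sgraph := SGraph {
  vertex :> finType;
  adj : rel vertex;
  adj_sym : symmetric adj;
  adj_irrefl : irreflexive adj
}.

Section CycleGraph.
Variable n : nat.

Definition cycle_adj : rel 'I_n :=
  [rel i j | (i != j) && ((ordS i == j) || (ordS j == i))].

Lemma cycle_adj_sym : symmetric cycle_adj.
Proof. by move=> i j; rewrite /cycle_adj /= eq_sym orbC. Qed.

Lemma cycle_adj_irrefl : irreflexive cycle_adj.
Proof. by move=> i; rewrite /cycle_adj /= eqxx. Qed.

(* This is the n-cycle only for n >= 3; for smaller n the conjunct i != j of
   cycle_adj keeps the graph loopless. *)
Definition cycle_graph := SGraph cycle_adj_sym cycle_adj_irrefl.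
End CycleGraph.

Section CartesianProduct.
Variables G H : sgraph.

Definition cart_adj : rel (G * H) :=
  [rel x y | ((x.1 == y.1) && adj x.2 y.2) || ((x.2 == y.2) && adj x.1 y.1)].

Lemma cart_adj_sym : symmetric cart_adj.
Proof.
move=> x y; rewrite /cart_adj /=.
by rewrite (eq_sym x.1) (eq_sym x.2) (adj_sym x.1) (adj_sym x.2).
Qed.

Lemma cart_adj_irrefl : irreflexive cart_adj.
Proof. by move=> x; rewrite /cart_adj /= !adj_irrefl !andbF. Qed.

Definition cart_prod := SGraph cart_adj_sym cart_adj_irrefl.
End CartesianProduct.

Section EdgeMetricDimension.
Variable G : sgraph.
Implicit Types (x y u v w : G) (e : {set G}) (S : {set G}).

Definition walk_of_length x y k :=
  [exists p : k.-tuple G, path (@adj G) x p && (last x p == y)].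

(* The least k < #|G| such that some walk of length k joins x to y; it takes
   the value #|G| when x and y lie in different components. *)
Definition dist x y : nat := find (walk_of_length x y) (iota 0 #|G|).

Definition edges : {set {set G}} :=
  [set e | [exists u, exists w, adj u w && (e == [set u; w])]].

(* Since dist is bounded by #|G|, the default value #|G| does not affect the
   minimum; see edge_distE. *)
Definition edge_dist e v : nat := \big[minn/#|G|]_(u in e) dist u v.

Definition distinguishes w e1 e2 := edge_dist e1 w != edge_dist e2 w.

Definition edge_metric_generator S :=
  [forall e1 in edges, forall e2 in edges,
     (e1 != e2) ==> [exists w in S, distinguishes w e1 e2]].

Lemma walkP x y k :
  reflect (exists p, [/\ path (@adj G) x p, last x p = y & size p = k])
          (walk_of_length x y k).
Proof.
apply: (iffP existsP) => [[p /andP[xp /eqP py]]|[p [xp py /eqP pk]]].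
  by exists p; rewrite size_tuple.
by exists (Tuple pk); rewrite /= xp py eqxx.
Qed.

Lemma dist_le_card x y : dist x y <= #|G|.
Proof. by rewrite -[X in _ <= X](size_iota 0) find_size. Qed.

Lemma dist_min x p : path (@adj G) x p -> dist x (last x p) <= size p.
Proof.
move=> xp; have [ltpG|] := ltnP (size p) #|G|; last exact: leq_trans (dist_le_card _ _).
rewrite leqNgt; apply/negP => /(before_find 0); rewrite nth_iota // add0n.
by move/walkP; apply; exists p.
Qed.

Lemma dist_shortest x y : connect (@adj G) x y ->
  exists p, [/\ path (@adj G) x p, last x p = y & size p = dist x y].
Proof.
case/connectP=> p0 xp0 ->; case/shortenP: xp0 => p xp up _.
set y' := last x p; apply/walkP.
have ltpG : size p < #|G| by rewrite -[(size p).+1]/(size (x :: p)) -(card_uniqP up) max_card.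
have hw : has (walk_of_length x y') (iota 0 #|G|).
  by apply/hasP; exists (size p); rewrite ?mem_iota //; apply/walkP; exists p.
have := nth_find 0 hw; rewrite nth_iota // -[X in _ < X](size_iota 0).
by rewrite -has_find.
Qed.

Lemma dist_eq0 x y : (dist x y == 0) = (x == y).
Proof.
have G0 : 0 < #|G| by apply/card_gt0P; exists x.
apply/eqP/eqP => [d0|->]; last first.
  by apply/eqP; rewrite -leqn0 -[y in dist _ y]/(last y [::]) (@dist_min y [::]).
have hw : has (walk_of_length x y) (iota 0 #|G|).
  by rewrite has_find size_iota -/(dist x y) d0.
have := nth_find 0 hw; rewrite -/(dist x y) d0 nth_iota //.
by case/walkP=> p [_ <- /size0nil->].
Qed.

Lemma edge_distE u w v :
  edge_dist [set u; w] v = minn (dist u v) (dist w v).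
Proof.
apply/eqP; rewrite eqn_leq; apply/andP; split.
  have le_big e z : z \in e -> edge_dist e v <= dist z v.
    rewrite /edge_dist => ze; have: z \in index_enum G by rewrite mem_index_enum.
    elim: (index_enum G) => // a s IHs; rewrite inE big_cons.
    case/predU1P=> [<-|/IHs les]; first by rewrite ze geq_minl.
    by case: ifP => // _; apply: leq_trans les; rewrite geq_minr.
  by rewrite leq_min !le_big ?set21 ?set22.
rewrite /edge_dist; elim/big_ind: _ => [||x].
- exact: leq_trans (geq_minl _ _) (dist_le_card _ _).
- by move=> a b ? ?; rewrite leq_min; apply/andP.
by case/set2P=> ->; rewrite ?geq_minl ?geq_minr.
Qed.

Lemma setT_edge_metric_generator : edge_metric_generator [set: G].
Proof.
have sep u w x y : u \notin [set x; y] ->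
    distinguishes u [set u; w] [set x; y].
  rewrite !inE negb_or /distinguishes !edge_distE => /andP[ux uy].
  have /eqP-> : dist u u == 0 by rewrite dist_eq0.
  rewrite min0n eq_sym -lt0n leq_min !lt0n !dist_eq0.
  by rewrite ![_ == u]eq_sym ux uy.
have sepS u w x y : ~~ ([set u; w] \subset [set x; y]) ->
    exists z, distinguishes z [set u; w] [set x; y].
  rewrite subUset !sub1set negb_and => /orP[] h; first by exists u; apply: sep.
  by exists w; rewrite setUC; apply: sep.
apply/forall_inP => e1; rewrite inE => /'exists_existsP[u [w /andP[_ /eqP->]]].
apply/forall_inP => e2; rewrite inE => /'exists_existsP[x [y /andP[_ /eqP->]]].
apply/implyP; rewrite eqEsubset negb_and => /orP[] /sepS[z zP];
  apply/exists_inP; exists z; rewrite ?inE //.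
by rewrite /distinguishes eq_sym.
Qed.

Definition edim : nat :=
  #|[arg min_(S < [set: G] | edge_metric_generator S) #|S|]|.

End EdgeMetricDimension.

(* Main.v *)
Require Import Defs.
From mathcomp Require Import all_boot.
From mathcomp Require Import zify.

Set Implicit Arguments.
Unset Strict Implicit.
Unset Printing Implicit Defensive.

(** Lower bound.  Let s be a vertex and S an edge metric generator.  The edges
    at s are all at distance 0 from s, and any other landmark w sees an edge
    su at distance either d(s, w) or d(s, w) - 1, so w gives one bit about u.
    Hence the neighbours of s inject into the subsets of S minus s
    ([degree_le_generator]).  In a graph of minimum degree at least 3, taking
    s in S, this forces S to have at least three elements ([edim_ge3]).

    Upper bound.  Double all the coordinates, so that the torus has
    circumferences 8r and 8t, vertices become points with two even coordinates
    and the edge with endpoints x, y becomes its midpoint, a point (p, q)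
    with exactly one odd coordinate.  Distances in the torus being L1
    distances, the distance from an edge to a vertex is, up to an affine
    change of scale, the L1 distance between the corresponding points
    ([edge_dist_torus]); this holds since the cycles are even.  Three landmarks
    then determine the midpoint ([torus_landmarks]):
    - (0, 0) and its antipode (4r, 0) in the first factor.  The sum of the two
      distances gives the distance from q to 0, and their difference that from
      p to 0.  So p and q are known up to the reflections p -> -p, q -> -q.
    - (2r, 2t), at a quarter turn in each factor.  A reflection replaces the
      distance from p to 2r, which lies between 0 and 4r, by its complement to
      4r.  If only p is reflected and the distance to the landmark is
      unchanged, then p is fixed by the reflection; likewise for q.  If both
      are reflected, then an unchanged distance equals 2r + 2t, which is even;
      but it has the parity of p + q, which is odd. *)

(** * Distances, generators and vertex degrees *)

Section Distance.
Variable G : sgraph.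
Implicit Types (x y u v w s : G) (S : {set G}).

Lemma distxx x : dist x x = 0.
Proof. by apply/eqP; rewrite dist_eq0. Qed.

Lemma dist_walk x y : dist x y < #|G| ->
  exists p, [/\ path (@adj G) x p, last x p = y & size p = dist x y].
Proof.
rewrite -[X in _ < X](size_iota 0) -has_find => hw; apply/walkP.
have := nth_find 0 hw; rewrite nth_iota //.
by rewrite has_find size_iota in hw.
Qed.

Lemma dist_adj u w v : adj u w -> dist u v <= (dist w v).+1.
Proof.
move=> uw; have [/dist_walk[p [wp <- <-]]|] := ltnP (dist w v) #|G|.
  by apply: (@dist_min _ u (w :: p)); rewrite /= uw.
by move=> /leqW; apply: leq_trans; apply: leq_trans (dist_le_card _ _) _.
Qed.

Lemma dist_descent x y : connect (@adj G) x y -> x != y ->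
  exists2 w, adj x w & (dist w y).+1 = dist x y.
Proof.
move=> /dist_shortest[[|w p] [/= xp py sp]] nxy; first by rewrite py eqxx in nxy.
have /andP[xw wp] := xp; exists w => //.
apply/eqP; rewrite eqn_leq dist_adj // andbT -sp -py ltnS.
exact: dist_min.
Qed.

(** A function that vanishes only at y, changes by at most one along an edge
    and can always be decreased by moving to a neighbour is the distance to y:
    the descent provides a walk of length f x, and along any walk to y the
    function decreases by at most one per step. *)
Lemma dist_potential y (f : G -> nat) :
    (forall x, (f x == 0) = (x == y)) ->
    (forall u w, adj u w -> f u <= (f w).+1) ->
    (forall x, 0 < f x -> exists2 w, adj x w & (f w).+1 = f x) ->
  (forall x, connect (@adj G) x y) /\ (forall x, dist x y = f x).
Proof.
move=> f0 flip fdesc.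
have walk x : exists p, [/\ path (@adj G) x p, last x p = y & size p = f x].
  move: {2}(f x) (erefl (f x)) => k; elim: k x => [|k IHk] x fx.
    by exists [::]; split=> //=; apply/eqP; rewrite -f0 fx.
  have [w xw fw] : exists2 w, adj x w & (f w).+1 = f x by apply: fdesc; rewrite fx.
  have [|p [wp py sp]] := IHk w; first by rewrite fx in fw; case: fw.
  by exists (w :: p); rewrite /= xw sp.
have f_le x p : path (@adj G) x p -> last x p = y -> f x <= size p.
  elim: p x => [|w p IHp] x /=; first by move=> _ ->; rewrite leqn0 f0.
  by case/andP=> xw wp py; apply: leq_trans (flip _ _ xw) _; rewrite ltnS IHp.
have conn x : connect (@adj G) x y.
  by have [p [xp py _]] := walk x; apply/connectP; exists p.
split=> // x; apply/eqP; rewrite eqn_leq; apply/andP; split.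
  by have [p [xp <- <-]] := walk x; apply: dist_min.
by have [p [xp py <-]] := dist_shortest (conn x); apply: f_le.
Qed.

(** An edge su is determined, among the edges at s, by the set of landmarks
    that are closer to u than to s; the landmark s itself never helps. *)
Lemma degree_le_generator S s : edge_metric_generator S ->
  #|[set u | adj s u]| <= 2 ^ #|S :\ s|.
Proof.
move=> genS; rewrite -card_powerset.
pose closer u := [set w in S :\ s | dist u w < dist s w].
have edge_at u w : adj s u ->
    edge_dist [set s; u] w = dist s w - (dist u w < dist s w).
  move=> su; rewrite edge_distE; have := dist_adj w su.
  by lia.
have inj_closer : {in [set u | adj s u] &, injective closer}.
  move=> u v; rewrite !inE => su sv eq_uv; apply/eqP/negPn/negP=> nuv.
  have in_edges z : adj s z -> [set s; z] \in edges G.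
    by move=> sz; rewrite inE; apply/'exists_existsP; exists s, z; rewrite sz eqxx.
  have nuv_edge : [set s; u] != [set s; v].
    apply: contra nuv => /eqP/setP/(_ u); rewrite !inE eqxx orbT.
    by move/esym/orP=> [/eqP us|//]; rewrite us adj_irrefl in su.
  have /forall_inP/(_ _ (in_edges _ su))/forall_inP/(_ _ (in_edges _ sv)) := genS.
  rewrite nuv_edge => /exists_inP[w wS]; rewrite /distinguishes !edge_at //.
  have [->|nws] := eqVneq w s.
    by rewrite distxx.
  by have /setP/(_ w) := eq_uv; rewrite !inE nws wS /= => ->; rewrite eqxx.
rewrite -(card_in_imset inj_closer); apply/subset_leq_card/subsetP.
by move=> _ /imsetP[u _ ->]; rewrite powersetE; apply/subsetP=> w; rewrite inE => /andP[].
Qed.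

Lemma edim_le (S : {set G}) : edge_metric_generator S -> edim G <= #|S|.
Proof.
rewrite /edim; case: arg_minnP; first exact: setT_edge_metric_generator.
by move=> S0 _ min_S0; apply: min_S0.
Qed.

Lemma edim_generator : exists2 S : {set G}, edge_metric_generator S & #|S| = edim G.
Proof.
rewrite /edim; case: arg_minnP; first exact: setT_edge_metric_generator.
by move=> S0 gen _; exists S0.
Qed.

(** The degree bound is applied at a vertex of S, where it loses a factor 2;
    the arbitrary vertex s0 is only there to exclude the empty generator. *)
Lemma edim_ge3 s0 : (forall s, 2 < #|[set u | adj s u]|) -> 2 < edim G.
Proof.
move=> deg3; have [S gen <-] := edim_generator.
have [s Ss|S0] := pickP (mem S).
  have := leq_trans (deg3 s) (degree_le_generator s gen).
  rewrite (cardsD1 s S) [s \in S]Ss.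
  by case: #|S :\ s| => [|[|k]].
have := leq_trans (deg3 s0) (degree_le_generator s0 gen).
have -> : S = set0 by apply/setP=> x; rewrite inE; apply: S0.
by rewrite set0D cards0.
Qed.

End Distance.

(** * Distances in products and cycles *)

Lemma dist_cart (G H : sgraph) (x y : cart_prod G H) :
    (forall u v : G, connect (@adj G) u v) ->
    (forall u v : H, connect (@adj H) u v) ->
  dist x y = dist x.1 y.1 + dist x.2 y.2.
Proof.
move=> connG connH; case: y => a b /=.
apply: (proj2 (@dist_potential (cart_prod G H) (a, b)
  (fun x => dist x.1 a + dist x.2 b) _ _ _)).
- by case=> u v; rewrite addn_eq0 !dist_eq0 xpair_eqE.
- move=> [u v] [w z] /= /orP[] /andP[/= /eqP -> h].
    by rewrite -addnS leq_add2l dist_adj.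
  by rewrite -addSn leq_add2r dist_adj.
case=> u v /=; have [->|nua _] := eqVneq u a.
  have [->|nvb _] := eqVneq v b.
    by rewrite !distxx.
  have [w vw <-] := dist_descent (connH v b) nvb.
  by exists (a, w); rewrite ?addnS //= /cart_adj /= eqxx vw.
have [w uw <-] := dist_descent (connG u a) nua.
by exists (w, v); rewrite ?addSn //= /cart_adj /= eqxx uw orbT.
Qed.

(** Number of forward steps from j to i around the n-cycle, for i, j < n. *)
Definition turn n i j := if j <= i then i - j else n + i - j.

(** Length of the shorter of two complementary arcs, one of them of length d. *)
Definition arc_dist n d := minn d (n - d).

(** The cyclic distance is stated on natural numbers so that it also measures
    the doubled coordinates. *)
Definition cdist n i j := arc_dist n (turn n i j).

Lemma val_ordS n (i : 'I_n) : ordS i = (if i.+1 == n then 0 else i.+1) :> nat.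
Proof.
rewrite /=; case: eqP => [->|/eqP ni]; first by rewrite modnn.
by rewrite modn_small // ltn_neqAle ni ltn_ord.
Qed.

Lemma ordS_neq n (i : 'I_n) : 1 < n -> ordS i != i.
Proof.
move=> n1; apply/eqP => /(congr1 val); rewrite [val _]val_ordS.
by case: eqP => /=; lia.
Qed.

Lemma ord_pred_neq n (i : 'I_n) : 1 < n -> ord_pred i != i.
Proof.
by move=> n1; rewrite -(inj_eq (@ordS_inj n)) ord_predK eq_sym ordS_neq.
Qed.

Lemma ordS_neq_pred n (i : 'I_n) : 2 < n -> ordS i != ord_pred i.
Proof.
move=> n2; have := ltn_ord i; rewrite -(inj_eq (@ordS_inj n)) ord_predK => ni.
apply/eqP => /(congr1 val); rewrite [val _]val_ordS val_ordS.
by do 2!case: eqP => /=; lia.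
Qed.

Lemma turn_ordS n (i j : 'I_n) :
  turn n (ordS i) j = if (turn n i j).+1 == n then 0 else (turn n i j).+1.
Proof.
have := ltn_ord i; have := ltn_ord j; rewrite val_ordS /turn => jn ni.
case: (leqP j i) => ji; case: eqP => [en|nn]; case: eqP => [eD|nD]; case: ifP; lia.
Qed.

(** Both arcs of a full turn have distance 0, so stepping onto j needs no
    special case. *)
Lemma cdist_ordS n (i j : 'I_n) : cdist n (ordS i) j = arc_dist n (turn n i j).+1.
Proof.
rewrite /cdist turn_ordS; case: eqP => // ->.
by rewrite /arc_dist subnn minn0 min0n.
Qed.

Lemma turn_lt n (i j : 'I_n) : turn n i j < n.
Proof.
by have := ltn_ord i; have := ltn_ord j; rewrite /turn => ? ?; case: ifP; lia.
Qed.

Lemma cdist_ord_pred n (i j : 'I_n) : 0 < turn n i j ->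
  cdist n (ord_pred i) j = arc_dist n (turn n i j).-1.
Proof. by rewrite -{1 3}[i]ord_predK turn_ordS /cdist; case: eqP. Qed.

Lemma cdist_eq0 n (i j : 'I_n) : (cdist n i j == 0) = (i == j).
Proof.
have := ltn_ord i; have := ltn_ord j; rewrite -val_eqE /cdist /arc_dist /turn /= => ? ?.
by case: ifP; lia.
Qed.

Lemma dist_cycle n (i j : cycle_graph n) :
  connect (@adj (cycle_graph n)) i j /\ dist i j = cdist n i j.
Proof.
suff [conn d] : (forall x : cycle_graph n, connect (@adj (cycle_graph n)) x j) /\
  (forall x, dist x j = cdist n x j) by split; rewrite ?conn ?d.
apply: dist_potential => [x|u w /= /andP[_ /orP[] /eqP <-]|x].
- exact: cdist_eq0.
- by have := turn_lt u j; rewrite cdist_ordS /cdist /arc_dist; lia.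
- by have := turn_lt w j; rewrite cdist_ordS /cdist /arc_dist; lia.
move=> x0; have n1 : 1 < n.
  by have := turn_lt x j; move: x0; rewrite /cdist /arc_dist; lia.
(* Descend along the shorter arc. *)
have [short|long] := leqP (turn n x j).*2 n.
  exists (ord_pred x).
    by rewrite /= /cycle_adj /= ord_predK eqxx orbT andbT eq_sym ord_pred_neq.
  have D0 : 0 < turn n x j by move: x0; rewrite /cdist /arc_dist; lia.
  by rewrite cdist_ord_pred // /cdist /arc_dist; lia.
exists (ordS x); first by rewrite /= /cycle_adj /= eqxx eq_sym ordS_neq.
have := turn_lt x j; rewrite cdist_ordS /cdist /arc_dist; lia.
Qed.

(** * Locating a point of a torus from three landmarks *)

Lemma cdist0 n p : cdist n p 0 = minn p (n - p).
Proof. by rewrite /cdist /turn subn0. Qed.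

Lemma cdist0_reflect n p p' : p < n -> p' < n ->
  cdist n p 0 = cdist n p' 0 -> p = p' \/ p + p' = n.
Proof. rewrite !cdist0; lia. Qed.

Lemma cdist_antipode r p : p < 8 * r ->
  cdist (8 * r) p (4 * r) + cdist (8 * r) p 0 = 4 * r.
Proof. by move=> ?; rewrite cdist0 /cdist /arc_dist /turn; case: ifP; lia. Qed.

Lemma cdist_quarter_reflect r p p' : p < 8 * r -> p + p' = 8 * r ->
  cdist (8 * r) p (2 * r) + cdist (8 * r) p' (2 * r) = 4 * r.
Proof. by move=> *; rewrite /cdist /arc_dist /turn; do 2!case: ifP => ?; lia. Qed.

(** By [cdist_quarter_reflect] both distances are 2r, so p is fixed by the
    reflection: it is 0 or 4r, and 0 is excluded since p' < 8r. *)
Lemma cdist_quarter_inj r p p' : p < 8 * r -> p' < 8 * r -> p + p' = 8 * r ->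
  cdist (8 * r) p (2 * r) = cdist (8 * r) p' (2 * r) -> p = p'.
Proof.
by move=> ? ? ?; rewrite /cdist /arc_dist /turn; do 2!case: ifP => ?; lia.
Qed.

Lemma odd_cdist_quarter r p : p < 8 * r -> odd (cdist (8 * r) p (2 * r)) = odd p.
Proof. by move=> ?; rewrite /cdist /arc_dist /turn; case: ifP; lia. Qed.

(** The parity hypothesis rules out the reflection of both coordinates at once:
    it expresses that (p, q) is the midpoint of an edge. *)
Lemma torus_landmarks r t p q p' q' :
    p < 8 * r -> p' < 8 * r -> q < 8 * t -> q' < 8 * t -> odd (p + q) ->
    cdist (8 * r) p 0 + cdist (8 * t) q 0 =
      cdist (8 * r) p' 0 + cdist (8 * t) q' 0 ->
    cdist (8 * r) p (4 * r) + cdist (8 * t) q 0 =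
      cdist (8 * r) p' (4 * r) + cdist (8 * t) q' 0 ->
    cdist (8 * r) p (2 * r) + cdist (8 * t) q (2 * t) =
      cdist (8 * r) p' (2 * r) + cdist (8 * t) q' (2 * t) ->
  p = p' /\ q = q'.
Proof.
move=> pr p'r qt q't odd_pq d0 d1 d2.
have [ep eq] : cdist (8 * r) p 0 = cdist (8 * r) p' 0 /\
               cdist (8 * t) q 0 = cdist (8 * t) q' 0.
  have ap := cdist_antipode pr; have ap' := cdist_antipode p'r.
  by clear -ap ap' d0 d1; lia.
case: (cdist0_reflect pr p'r ep) (cdist0_reflect qt q't eq) => [{}ep|{}ep] [{}eq|{}eq].
- by [].
- split=> //; apply: cdist_quarter_inj qt q't eq _.
  by move/eqP: d2; rewrite ep eqn_add2l => /eqP.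
- split=> //; apply: cdist_quarter_inj pr p'r ep _.
  by move/eqP: d2; rewrite eq eqn_add2r => /eqP.
(* Both coordinates reflected: the common value is half of 4r + 4t. *)
have half : cdist (8 * r) p (2 * r) + cdist (8 * t) q (2 * t) = (r + t).*2.
  have sp := cdist_quarter_reflect pr ep; have sq := cdist_quarter_reflect qt eq.
  by clear -sp sq d2; lia.
by move/(congr1 odd): half; rewrite oddD !odd_cdist_quarter // -oddD odd_pq odd_double.
Qed.

(** * Edges of an even torus as midpoints *)

Lemma arc_dist_midpoint n d : ~~ odd n -> d < n ->
  (minn (arc_dist n d) (arc_dist n d.+1)).*2.+1 = arc_dist (2 * n) d.*2.+1.
Proof.
rewrite /arc_dist => /even_halfK <-; move: n./2 => k dk.
have [dlt|dge] := ltnP d k.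
  by rewrite !(minn_idPl _) //; lia.
by rewrite !(minn_idPr _) //; lia.
Qed.

Lemma cdist_double n i a : cdist (2 * n) (2 * i) (2 * a) = (cdist n i a).*2.
Proof. by rewrite /cdist /arc_dist /turn leq_pmul2l //; case: ifP; lia. Qed.

(** The endpoints of a cycle edge have distances to a that differ by exactly
    one, the cycle being even; the distance of the midpoint is their mean. *)
Lemma cdist_midpoint n (i a : 'I_n) : ~~ odd n ->
  (minn (cdist n i a) (cdist n (ordS i) a)).*2.+1 = cdist (2 * n) (2 * i + 1) (2 * a).
Proof.
move=> even_n; rewrite cdist_ordS arc_dist_midpoint ?turn_lt // /cdist.
by congr arc_dist; have an := ltn_ord a; rewrite /turn; do 2!case: ifP => ?; lia.
Qed.

Section Torus.
Variables n m : nat.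
Hypotheses (even_n : ~~ odd n) (even_m : ~~ odd m).
Local Notation torus := (cart_prod (cycle_graph n) (cycle_graph m)).
Implicit Types x y : torus.

(** Every edge has a starting vertex x and a direction: [b] tells whether the
    first coordinate is the one that increases. *)
Definition torus_edge x (b : bool) : {set torus} :=
  [set x; if b then (ordS x.1, x.2) else (x.1, ordS x.2)].

Lemma torus_edgeP e : e \in edges torus -> exists x b, e = torus_edge x b.
Proof.
rewrite inE => /'exists_existsP[[i j] [[k l] /andP[/= ijkl /eqP ->]]].
case/orP: ijkl => /andP[/= /eqP-> /andP[_ /orP[] /eqP<-]].
- by exists (k, j), false.
- by exists (k, l), false; rewrite setUC.
- by exists (i, l), true.
by exists (k, l), true; rewrite setUC.
Qed.

Lemma dist_torus x y : dist x y = cdist n x.1 y.1 + cdist m x.2 y.2.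
Proof.
by rewrite dist_cart => [|u v|u v]; rewrite ?(proj2 (dist_cycle _ _)) //;
  case: (dist_cycle u v).
Qed.

(** An edge has length 2 in doubled coordinates, so its midpoint is one further
    away than its nearer endpoint. *)
Lemma edge_dist_torus x b y :
  (edge_dist (torus_edge x b) y).*2.+1 =
    cdist (2 * n) (2 * x.1 + b) (2 * y.1) + cdist (2 * m) (2 * x.2 + ~~ b) (2 * y.2).
Proof.
rewrite edge_distE !dist_torus; case: x y => i j [k l]; case: b => /=.
  by rewrite -cdist_midpoint // addn0 cdist_double -addn_minl doubleD addSn.
by rewrite -cdist_midpoint // addn0 cdist_double -addn_minr doubleD addnS.
Qed.

End Torus.

(** * The edge metric dimension of the torus *)

Lemma torus_generator r t
    (u v w : cart_prod (cycle_graph (4 * r)) (cycle_graph (4 * t))) :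
    u.1 = 0 :> nat /\ u.2 = 0 :> nat ->
    v.1 = 2 * r :> nat /\ v.2 = 0 :> nat ->
    w.1 = r :> nat /\ w.2 = t :> nat ->
  edge_metric_generator [set u; v; w].
Proof.
move=> [u1 u2] [v1 v2] [w1 w2].
apply/forall_inP=> e /torus_edgeP[x [b ->]].
apply/forall_inP=> e' /torus_edgeP[x' [b' ->]].
apply/implyP; apply: contraNT => /exists_inPn same.
have even4 c : ~~ odd (4 * c) by rewrite oddM.
have eqd z : z \in [set u; v; w] ->
    edge_dist (torus_edge x b) z = edge_dist (torus_edge x' b') z.
  by move/same => /negPn/eqP.
have eqc z : z \in [set u; v; w] ->
    cdist (8 * r) (2 * x.1 + b) (2 * z.1) + cdist (8 * t) (2 * x.2 + ~~ b) (2 * z.2) =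
    cdist (8 * r) (2 * x'.1 + b') (2 * z.1) + cdist (8 * t) (2 * x'.2 + ~~ b') (2 * z.2).
  have e8 c : 8 * c = 2 * (4 * c) by rewrite mulnA.
  by move/eqd=> h; rewrite !e8 -!edge_dist_torus // h.
have := eqc u; have := eqc v; have := eqc w.
rewrite u1 u2 v1 v2 w1 w2 !inE !eqxx !orbT => /(_ isT) dw /(_ isT) dv /(_ isT) du.
have [x1 x'1] := (ltn_ord x.1, ltn_ord x'.1).
have [x2 x'2] := (ltn_ord x.2, ltn_ord x'.2).
have [||||||||p q] := @torus_landmarks r t (2 * x.1 + b) (2 * x.2 + ~~ b)
  (2 * x'.1 + b') (2 * x'.2 + ~~ b').
- lia.
- lia.
- lia.
- lia.
- lia.
- by move: du; rewrite muln0.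
- by move: dv; rewrite muln0 mulnA.
- by [].
have [eb [e1 e2]] : b = b' /\ (x.1 = x'.1 :> nat /\ x.2 = x'.2 :> nat) by lia.
rewrite eb; suff -> : x = x' by [].
by case: (x) (x') e1 e2 => i j [k l] /= /val_inj-> /val_inj->.
Qed.

Lemma torus_degree n m (s : cart_prod (cycle_graph n) (cycle_graph m)) :
  2 < n -> 1 < m -> 2 < #|[set u | adj s u]|.
Proof.
move=> n2 m1; case: s => i j.
pose nbrs := [:: (ordS i, j); (ord_pred i, j); (i, ordS j)].
have n1 : 1 < n by exact: ltnW.
have uniq_nbrs : uniq nbrs.
  rewrite /= !inE !xpair_eqE !eqxx /= negb_or !negb_and.
  by rewrite ordS_neq_pred // ordS_neq // ord_pred_neq.
rewrite -[3]/(size nbrs) -(card_uniqP uniq_nbrs).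
apply/subset_leq_card/subsetP=> z; rewrite !inE.
case/or3P=> /eqP->; rewrite /= /cart_adj /= /cycle_adj /= ?ord_predK !eqxx ?orbT ?andbT /=.
- by rewrite eq_sym ordS_neq ?orbT.
- by rewrite eq_sym ord_pred_neq ?orbT.
by rewrite eq_sym ordS_neq.
Qed.

Theorem theorem7 (r t : nat) (hr : 0 < r) (ht : 0 < t) :
  edim (cart_prod (cycle_graph (4 * r)) (cycle_graph (4 * t))) = 3.
Proof.
have r0 : 0 < 4 * r by lia.
have r2 : 2 * r < 4 * r by lia.
have r1 : r < 4 * r by lia.
have t0 : 0 < 4 * t by lia.
have t1 : t < 4 * t by lia.
pose G := cart_prod (cycle_graph (4 * r)) (cycle_graph (4 * t)).
pose u : G := (Ordinal r0, Ordinal t0).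
pose v : G := (Ordinal r2, Ordinal t0).
pose w : G := (Ordinal r1, Ordinal t1).
apply/eqP; rewrite eqn_leq; apply/andP; split.
  apply: leq_trans (edim_le (@torus_generator r t u v w _ _ _)) _ => //.
  by apply: leq_trans (leq_card_setU _ _) _; rewrite cards1 cards2; case: (_ != _).
by apply: (edim_ge3 u) => s; apply: torus_degree; lia.
Qed.
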